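(* Let $n\ge1$ and $N=2^n$. Let $|x_1\rangle,\dots,|x_N\rangle\in\mathbb{C}^N$ be linearly independent unit vectors that are pairwise nonorthogonal, i.e. $\langle x_j|x_k\rangle\ne0$ for all $j,k$. Let $U,V$ be unitaries on $\mathbb{C}^N$ such that $V$ is perfectly trained on the dataset $\{(|x_j\rangle,U|x_j\rangle)\}_{j=1}^N$. Then $R_U(V)=0$.
   Context: For unitaries $U,V$ on $\mathbb{C}^N$ the quantum risk is $$R_U(V)=1-\int |\langle\psi|U^\dagger V|\psi\rangle|^2\,d|\psi\rangle=1-\frac{N+|\operatorname{Tr}[U^\dagger V]|^2}{N(N+1)},$$ where the integral is over pure states with the uniform (Haar) probability measure. A unitary $V$ is perfectly trained on $\{(|x_j\rangle,U|x_j\rangle)\}_{j=1}^N$ if $V|x_j\rangle\langle x_j|V^\dagger=U|x_j\rangle\langle x_j|U^\dagger$ for all $j$; equivalently, $V|x_j\rangle=e^{i\theta_j}U|x_j\rangle$ for some real $\theta_j$. *)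

(* Defs.v *)
From HB Require Import structures.
From mathcomp Require Import all_boot all_order all_algebra.
From mathcomp Require Import sesquilinear spectral vector complex.
From mathcomp Require Import all_classical all_reals all_analysis.

Set Implicit Arguments.
Unset Strict Implicit.
Unset Printing Implicit Defensive.

Import Order.TTheory GRing.Theory Num.Theory.
Import numFieldNormedType.Exports.

Local Open Scope classical_set_scope.
Local Open Scope sesquilinear_scope.
Local Open Scope complex_scope.
Local Open Scope ring_scope.

(* C^N with its Borel sigma-algebra.  The [^o] is what gives R[i] its metric
   topology in MathComp-Analysis; the carrier is convertible to 'cV[R[i]]_N. *)
Notation ketT R N := (g_sigma_algebraType (@open 'cV[(R[i])^o]_N)).

(* <phi|psi>, conjugate-linear in phi.  [A ^t*] is the conjugate transpose. *)
Definition braket (R : realType) (N : nat) (phi psi : 'cV[R[i]]_N) : R[i] :=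
  (phi ^t* *m psi) 0 0.

Definition unit_ket (R : realType) (N : nat) (psi : 'cV[R[i]]_N) : Prop :=
  braket psi psi = 1.

(* |psi><psi| *)
Definition ketbra (R : realType) (N : nat) (psi : 'cV[R[i]]_N) : 'M[R[i]]_N :=
  psi *m psi ^t*.

(* Pure states are represented by unit vectors. *)
Definition pure_states (R : realType) (N : nat) : set (ketT R N) :=
  [set psi | unit_ket psi].

(* The uniform (Haar) distribution on pure states: the probability measure on
   the unit sphere of C^N invariant under every unitary.  These conditions
   determine it uniquely, the unitary group being compact and acting
   transitively on the sphere. *)
Definition haar_pure (R : realType) (N : nat)
    (mu : probability (ketT R N) R) : Prop :=
  mu (@pure_states R N) = 1%E /\
  forall (W : 'M[R[i]]_N) (A : set (ketT R N)),
    W \is unitarymx -> measurable A ->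
    mu ((fun psi : ketT R N => (W *m psi : ketT R N)) @^-1` A) = mu A.

(* [U] is the target unitary, [V] the hypothesis;
   complex.Re (`|z| ^+ 2) is the squared modulus of z as an element of R. *)
Definition quantum_risk (R : realType) (N : nat)
    (mu : probability (ketT R N) R) (U V : 'M[R[i]]_N) : R :=
  1 - \int[mu]_(psi in @pure_states R N)
        complex.Re (`| braket psi (U ^t* *m V *m psi) | ^+ 2).

Definition perfectly_trained (R : realType) (N t : nat)
    (x : 'I_t -> 'cV[R[i]]_N) (U V : 'M[R[i]]_N) : Prop :=
  forall j : 'I_t,
    V *m ketbra (x j) *m V ^t* = U *m ketbra (x j) *m U ^t*.

(* Main.v *)
(** Being perfectly trained makes every x_j an eigenvector of the unitary
    W = U^t* V, say W x_j = c_j x_j.  Since W preserves inner products,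
    conj(c_j) c_k <x_j|x_k> = <x_j|x_k>, so nonorthogonality forces all the
    c_j to be one phase c.  The x_j form a basis, hence W = c I: the integrand
    of the risk is |c|^2 = 1 on every pure state. *)

Require Import Defs.
From HB Require Import structures.
From mathcomp Require Import all_boot all_order all_algebra.
From mathcomp Require Import sesquilinear spectral vector complex.
From mathcomp Require Import all_classical all_reals all_analysis.
Import Order.TTheory GRing.Theory Num.Theory.
Import numFieldNormedType.Exports.
Local Open Scope classical_set_scope.
Local Open Scope sesquilinear_scope.
Local Open Scope complex_scope.
Local Open Scope ring_scope.

Lemma braketE {R : realType} {N : nat} (phi psi : 'cV[R[i]]_N) :
  braket phi psi = \sum_i (phi i 0)^* * psi i 0.
Proof. by rewrite /braket mxE; apply: eq_bigr => i _; rewrite !mxE. Qed.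

Lemma braketZr {R : realType} {N : nat} (c : R[i]) (phi psi : 'cV[R[i]]_N) :
  braket phi (c *: psi) = c * braket phi psi.
Proof. by rewrite /braket -scalemxAr mxE. Qed.

Lemma braketZl {R : realType} {N : nat} (c : R[i]) (phi psi : 'cV[R[i]]_N) :
  braket (c *: phi) psi = c^* * braket phi psi.
Proof.
rewrite !braketE mulr_sumr; apply: eq_bigr => i _.
by rewrite mxE rmorphM mulrA.
Qed.

Lemma trmxCM {R : realType} {m n p : nat}
    (A : 'M[R[i]]_(m, n)) (B : 'M[R[i]]_(n, p)) :
  (A *m B) ^t* = B ^t* *m A ^t*.
Proof. by rewrite trmx_mul map_mxM. Qed.

Lemma unitarymx_trmxC_mul {R : realType} {N : nat} {W : 'M[R[i]]_N} :
  W \is unitarymx -> W ^t* *m W = 1%:M.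
Proof. by move/unitarymxP/mulmx1C. Qed.

Lemma braket_unitary {R : realType} {N : nat} {W : 'M[R[i]]_N}
    (phi psi : 'cV[R[i]]_N) :
  W \is unitarymx -> braket (W *m phi) (W *m psi) = braket phi psi.
Proof.
move=> hW; rewrite /braket trmxCM mulmxA -(mulmxA (phi ^t*)).
by rewrite (unitarymx_trmxC_mul hW) mulmx1.
Qed.

(* Stated over an abstract numFieldType because the canonical topology is found
   on its elements, but on [R[i]] only through [^o]; the two are convertible. *)
Lemma closed_sphere {K : numFieldType} {N : nat} :
  closed [set psi : 'cV[K]_N | \sum_i `|psi i 0| ^+ 2 = 1 :> K].
Proof.
pose f (psi : 'cV[K]_N) : K := \sum_i `|psi i 0| ^+ 2.
have cf : continuous f.
  apply: (continuous_big add_continuous) => i _ psi.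
  apply: (@continuous_comp _ _ _ (fun p : 'cV[K]_N => p i 0)
    (fun z : K => `|z| ^+ 2 : K)); first exact: coord_continuous.
  apply: (@continuous_comp _ _ _ (fun z : K => `|z| : K) (fun z : K => z * z)).
    exact: norm_continuous.
  by apply: (@cvgM K K (nbhs `|psi i 0|) _ id id); apply: cvg_id.
rewrite (_ : mkset _ = f @^-1` [set 1])//.
apply: preimage_closed => [psi _|]; first exact: cf.
exact: accessible_closed_set1 (hausdorff_accessible (@norm_hausdorff _ _)) _.
Qed.

(** The unit sphere is closed, hence Borel; this allows a constant to be integrated over it in the
    risk. *)
Lemma measurable_pure_states {R : realType} {N : nat} :
  measurable (@pure_states R N).
Proof.
(* The sigma-algebra is generated by the open sets, so the sphere is presented as the complement of
   an open set. *)
have -> : @pure_states R N =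
    ~` ~` [set psi : 'cV[R[i]]_N | \sum_i `|psi i 0| ^+ 2 = 1].
  rewrite setCK; apply/seteqP; split => psi; rewrite /pure_states /unit_ket /=
    braketE => <-; apply: eq_bigr => i _; by rewrite normCK mulrC.
apply: measurableC; apply: sub_sigma_algebra; apply: closed_openC.
exact: (@closed_sphere R[i] N).
Qed.

(** Multiply the training identity by [U ^t*] on the left and by [V *m x j] on the right. As [x j]
    is a unit vector, the left side collapses to W x_j with W = U^t* V, and the right side to x_j
    <x_j|W x_j>; the eigenvalue is thus <x_j|W x_j>. *)
Lemma perfectly_trained_eigen {R : realType} {N t : nat}
    {x : 'I_t -> 'cV[R[i]]_N} {U V : 'M[R[i]]_N} {j : 'I_t} :
  U \is unitarymx -> V \is unitarymx -> unit_ket (x j) ->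
  perfectly_trained x U V ->
  exists c : R[i], (U ^t* *m V) *m x j = c *: x j.
Proof.
move=> hU hV hx /(_ j) /(congr1 (fun M => U ^t* *m M *m (V *m x j))).
have hx1 : (x j) ^t* *m x j = 1%:M by rewrite [LHS]mx11_scalar -hx.
rewrite /ketbra => h; exists (((x j)^t* *m U ^t* *m V *m x j) 0 0).
(* The eigenvalue is read as a 1 x 1 matrix, so that both sides become matrix products open to
   reassociation. *)
rewrite -mul_mx_scalar -mx11_scalar.
move: h; rewrite !mulmxA.
rewrite -(mulmxA _ (V ^t*) V) (unitarymx_trmxC_mul hV) mulmx1.
by rewrite -(mulmxA _ _ (x j)) hx1 mulmx1 (unitarymx_trmxC_mul hU) mul1mx.
Qed.

Lemma perfectly_trained_scalar {R : realType} {N : nat}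
    {x : 'I_N -> 'cV[R[i]]_N} {U V : 'M[R[i]]_N} :
  (0 < N)%N -> free [tuple x j | j < N] ->
  (forall j, unit_ket (x j)) ->
  (forall j k, braket (x j) (x k) != 0) ->
  U \is unitarymx -> V \is unitarymx -> perfectly_trained x U V ->
  exists2 c : R[i], `|c| = 1 &
    forall psi : 'cV[R[i]]_N, U ^t* *m V *m psi = c *: psi.
Proof.
move=> N0 hfree hunit hno hU hV htr.
have hW : U ^t* *m V \is unitarymx.
  by rewrite mul_unitarymx// trmxC_unitary.
have /fin_all_exists[c hc] j := perfectly_trained_eigen hU hV (hunit j) htr.
have cc j k : (c j)^* * c k = 1.
  apply: (mulIf (hno j k)); rewrite mul1r -mulrA -braketZr -braketZl -!hc.
  exact: braket_unitary.
pose j0 := Ordinal N0.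
(* The diagonal case of [cc] says that the squared modulus is 1. *)
have c1 : `|c j0| = 1.
  by apply/eqP; rewrite -(@pexpr_eq1 _ _ 2)// normCK mulrC cc.
exists (c j0) => // psi.
(* By [cc], both [c k] and [c j0] are inverse to the conjugate of [c j0]. *)
have ck k : c k = c j0.
  have nz : (c j0)^* != 0 by apply: contra_eq_neq (cc j0 j0) => ->;
    rewrite mul0r eq_sym oner_eq0.
  by apply: (mulfI nz); rewrite !cc.
(* A free family of N vectors spans, since N x 1 matrices form a space of dimension N * 1. *)
have hb : basis_of fullv [tuple x j | j < N].
  by rewrite basisEfree hfree subvf size_tuple dimvf /dim/= muln1 leqnn.
rewrite (coord_basis hb (memvf psi)) mulmx_sumr scaler_sumr.
apply: eq_bigr => i _.
by rewrite -scalemxAr -tnth_nth tnth_mktuple hc ck !scalerA mulrC.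
Qed.

Theorem corollaryS2 (R : realType) (n N : nat) (hn : (1 <= n)%N)
    (hN : N = (2 ^ n)%N)
    (mu : probability (ketT R N) R) (hmu : haar_pure mu)
    (x : 'I_N -> 'cV[R[i]]_N)
    (hfree : free [tuple x j | j < N])
    (hunit : forall j : 'I_N, unit_ket (x j))
    (hnonorth : forall j k : 'I_N, braket (x j) (x k) != 0)
    (U V : 'M[R[i]]_N)
    (hU : U \is unitarymx) (hV : V \is unitarymx)
    (htrained : perfectly_trained x U V) :
  quantum_risk mu U V = 0.
Proof.
have N0 : (0 < N)%N by rewrite hN expn_gt0.
have [c c1 hc] :=
  perfectly_trained_scalar N0 hfree hunit hnonorth hU hV htrained.
have mS := @measurable_pure_states R N.
rewrite /quantum_risk (@eq_Rintegral _ _ _ _ _ (cst 1)); last first.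
  by move=> psi; rewrite inE => hpsi; rewrite hc braketZr hpsi mulr1 c1 expr1n.
rewrite Rintegral_cst//.
(* The integral of 1 is the mass of the sphere, which is 1 by the normalization in [haar_pure]. *)
by rewrite [X in fine X](hmu.1) mul1r subrr.
Qed.
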